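(* $\mathsf{PK}_{\mathbb{N}^{\mathbb{N}}}<_{\mathrm{W}}\widehat{\mathsf{WF}}\equiv_{\mathrm{W}}\mathsf{PK}\le_{\mathrm{W}}\mathsf{lim}*\mathsf{PK}_{\mathbb{N}^{\mathbb{N}}}$.
   Context: A represented space is a set $X$ with a partial surjection $\delta_X:\subseteq\mathbb{N}^{\mathbb{N}}\to X$; $p$ is a name of $x$ if $\delta_X(p)=x$. A problem is a partial multi-valued function $f:\subseteq X\rightrightarrows Y$ between represented spaces. $f\le_{\mathrm{W}} g$ (Weihrauch reducibility) means that there are computable partial maps $\Phi,\Psi:\subseteq\mathbb{N}^{\mathbb{N}}\to\mathbb{N}^{\mathbb{N}}$ such that for every name $p$ of some $x\in\mathrm{dom}(f)$, $\Phi(p)$ is a name of some $y\in\mathrm{dom}(g)$, and for every name $q$ of an element of $g(y)$, $\Psi(p*q)$ is a name of an element of $f(x)$, where $p*q$ is the interleaving of $p$ and $q$. $f\equiv_{\mathrm{W}}g$ means reducibility both ways; $f<_{\mathrm{W}}g$ means $f\le_{\mathrm{W}}g$ and $g\not\le_{\mathrm{W}}f$. The infinite parallelization of $f$ is $\widehat f((x_i)_{i\in\mathbb{N}})=\{(y_i)_{i\in\mathbb{N}}:(\forall i)\,y_i\in f(x_i)\}$. The compositional product $f*g$ is any problem whose Weihrauch degree is $\max_{\le_{\mathrm{W}}}\{f_1\circ g_1: f_1\le_{\mathrm{W}}f,\ g_1\le_{\mathrm{W}}g\}$ (this maximum is known to exist). A tree is a subset $T$ of $\mathbb{N}^{<\mathbb{N}}$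 closed under initial segments (the empty set is allowed); $[T]$ is its set of infinite paths; $T$ is well-founded if $[T]=\emptyset$. $\mathbf{Tr}$ is the space of trees, a tree being represented by its characteristic function (via a fixed computable bijection $\mathbb{N}^{<\mathbb{N}}\cong\mathbb{N}$). A tree is perfect if each of its elements has two incomparable extensions in it; the perfect kernel of $T$ is the largest perfect subtree of $T$. $\mathcal{A}(\mathbb{N}^{\mathbb{N}})$ is the space of closed subsets of Baire space, a name of $C$ being (the characteristic function of) a tree $T$ with $[T]=C$. A closed set is perfect if it has no isolated points; the perfect kernel of a closed set $A$ is the unique perfect $P\subseteq A$ with $A\setminus P$ countable. $\mathsf{WF}:\mathbf{Tr}\to\{0,1\}$ is given by $\mathsf{WF}(T)=1$ iff $T$ is well-founded. $\mathsf{PK}:\mathbf{Tr}\to\mathbf{Tr}$ maps a tree to its perfect kernel. $\mathsf{PK}_{\mathbb{N}^{\mathbb{N}}}:\mathcal{A}(\mathbb{N}^{\mathbb{N}})\to\mathcal{A}(\mathbb{N}^{\mathbb{N}})$ maps a closed set to its perfect kernel. $\mathsf{lim}:\subseteq(\mathbb{N}^{\mathbb{N}})^{\mathbb{N}}\to\mathbb{N}^{\mathbb{N}}$ maps a converging sequence in Baire space to its limit. *)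

(* Defs.v *)
From mathcomp Require Import all_boot all_classical all_analysis.
From Stdlib Require Cantor.

Set Implicit Arguments.
Unset Strict Implicit.
Unset Printing Implicit Defensive.

Local Open Scope classical_set_scope.

Notation baire := (prod_topology (fun _ : nat => nat)).

Notation npair a b := (Cantor.to_nat (a, b)).
Notation nfst n := (Cantor.of_nat n).1.
Notation nsnd n := (Cantor.of_nat n).2.

(* Programs for the unary partial functions on nat that are mu-recursive
   relative to an oracle; several arguments are passed as one Cantor pair. *)
Inductive prog : Type :=
  | Zero
  | Succ
  | Fst
  | Snd
  | Oracle
  | Pair of prog & prog
  | Comp of prog & prog
  | Prec of prog & prog
  | Mu of prog.

(* [eval p e n m]: with oracle p, program e halts on input n with output m. *)
Fixpoint eval (p : baire) (e : prog) : nat -> nat -> Prop :=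
  match e with
  | Zero => fun _ m => m = 0
  | Succ => fun n m => m = n.+1
  | Fst => fun n m => m = nfst n
  | Snd => fun n m => m = nsnd n
  | Oracle => fun n m => m = p n
  | Pair a b => fun n m => exists x y,
      [/\ eval p a n x, eval p b n y & m = npair x y]
  | Comp a b => fun n m => exists2 x, eval p b n x & eval p a x m
  | Prec a b => fun n m =>
      (fix iter (k : nat) : nat -> Prop :=
         match k with
         | 0 => fun r => eval p a (nfst n) r
         | k'.+1 => fun r => exists2 s,
             iter k' s & eval p b (npair (nfst n) (npair k' s)) r
         end) (nsnd n) m
  | Mu a => fun n m =>
      eval p a (npair n m) 0 /\
      forall i, i < m -> exists v, eval p a (npair n i) v.+1
  end.

(* The program may halt on more oracles than the domain of F. *)
Definition computable (F : baire -> option baire) : Prop :=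
  exists e, forall p q, F p = Some q -> forall n, eval p e n (q n).

(* The representation is given by its graph: [rname p x] means that p is a
   name of x. *)
Record repSpace : Type := RepSpace {
  rcarrier :> Type;
  rname : baire -> rcarrier -> Prop;
  rname_functional : forall p x y, rname p x -> rname p y -> x = y;
  rname_surjective : forall x, exists p, rname p x }.

Arguments rname {_} _ _.

Definition problem (X Y : repSpace) : Type := X -> set Y.

Definition pdom (X Y : repSpace) (f : problem X Y) : set X :=
  [set x | f x !=set0].

Definition interleave (p q : baire) : baire :=
  fun n => if odd n then q n./2 else p n./2.

Definition weihrauch_le (X Y Z W : repSpace)
    (f : problem X Y) (g : problem Z W) : Prop :=
  exists Phi Psi : baire -> option baire,
    [/\ computable Phi, computable Psi &
      forall (p : baire) (x : X), rname p x -> pdom f x ->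
      exists (p' : baire) (y : Z),
        [/\ Phi p = Some p', rname p' y, pdom g y &
          forall (q : baire) (z : W), rname q z -> g y z ->
          exists (r : baire) (w : Y),
            [/\ Psi (interleave p q) = Some r, rname r w & f x w]]].

Definition weihrauch_equiv (X Y Z W : repSpace)
    (f : problem X Y) (g : problem Z W) : Prop :=
  weihrauch_le f g /\ weihrauch_le g f.

Definition weihrauch_lt (X Y Z W : repSpace)
    (f : problem X Y) (g : problem Z W) : Prop :=
  weihrauch_le f g /\ ~ weihrauch_le g f.

(* Composition of multi-valued maps: every value of g must lie in the domain
   of f. *)
Definition pcomp (X Y Z : repSpace) (f : problem Y Z) (g : problem X Y) :
    problem X Z :=
  fun x => [set z | g x `<=` pdom f /\ exists2 y, g x y & f y z].

(* The compositional product is only defined up to equivalence, so it is a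
   predicate: h represents the maximal degree among the compositions. *)
Definition is_comp_product (X Y Z W U V : repSpace)
    (f : problem X Y) (g : problem Z W) (h : problem U V) : Prop :=
  (exists (A B C : repSpace) (f1 : problem B C) (g1 : problem A B),
    [/\ weihrauch_le f1 f, weihrauch_le g1 g &
        weihrauch_equiv h (pcomp f1 g1)]) /\
  (forall (A B C : repSpace) (f1 : problem B C) (g1 : problem A B),
    weihrauch_le f1 f -> weihrauch_le g1 g -> weihrauch_le (pcomp f1 g1) h).

Definition proj_seq (p : baire) (i : nat) : baire := fun n => p (npair i n).

Section SeqSpace.
Variable X : repSpace.

Definition seq_name (p : baire) (x : nat -> X) : Prop :=
  forall i, rname (proj_seq p i) (x i).

Lemma seq_name_functional p x y : seq_name p x -> seq_name p y -> x = y.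
Proof. by move=> px py; apply: funext => i; exact: rname_functional. Qed.

Lemma seq_name_surjective x : exists p, seq_name p x.
Proof.
have /choice[q qx] : forall i, exists p : baire, rname p (x i).
  by move=> i; exact: rname_surjective.
exists (fun n => q (nfst n) (nsnd n)) => i.
suff -> : proj_seq (fun n => q (nfst n) (nsnd n)) i = q i by [].
by apply: funext => n; rewrite /proj_seq Cantor.cancel_of_to.
Qed.

Definition seq_space : repSpace :=
  RepSpace seq_name_functional seq_name_surjective.

End SeqSpace.

Definition parallelization (X Y : repSpace) (f : problem X Y) :
    problem (seq_space X) (seq_space Y) :=
  fun x => [set y | forall i, f (x i) (y i)].

Definition bool_name (p : baire) (b : bool) : Prop := p 0 = b.

Lemma bool_name_functional p b c : bool_name p b -> bool_name p c -> b = c.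
Proof. by rewrite /bool_name => ->; case: b; case: c. Qed.

Lemma bool_name_surjective b : exists p, bool_name p b.
Proof. by exists (fun=> b : nat). Qed.

Definition bool_space : repSpace :=
  RepSpace bool_name_functional bool_name_surjective.

Definition baire_space : repSpace :=
  @RepSpace baire (fun p x => p = x)
    (fun p x y px py => etrans (esym px) py) (fun x => ex_intro _ x erefl).

Fixpoint seq_code (s : seq nat) : nat :=
  if s is a :: s' then (npair a (seq_code s')).+1 else 0.

Lemma seq_code_inj : injective seq_code.
Proof.
elim=> [|a s IH] [|b t] //= [] /(@Cantor.to_nat_inj (_, _) (_, _)).
by case=> -> /IH ->.
Qed.

Lemma seq_code_surj n : exists s, seq_code s = n.
Proof.
have [k] := ubnP n; elim: k n => // k IH [|n] nk; first by exists [::].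
have [|s sE] := IH (nsnd n).
  have := Cantor.to_nat_non_decreasing (nfst n) (nsnd n).
  rewrite -surjective_pairing Cantor.cancel_to_of => /leP le.
  by apply: leq_ltn_trans (nk : n < k); apply: leq_trans le; exact: leq_addr.
exists (nfst n :: s); rewrite -[in RHS](Cantor.cancel_to_of n).
by case: (Cantor.of_nat n) sE => a b /= <-.
Qed.

Definition is_tree (T : set (seq nat)) : Prop :=
  forall s t, prefix s t -> T t -> T s.

Definition tree : Type := {T : set (seq nat) | is_tree T}.

Definition tree_name (p : baire) (T : tree) : Prop :=
  forall s, p (seq_code s) = `[< sval T s >].

Lemma tree_name_functional p S T : tree_name p S -> tree_name p T -> S = T.
Proof.
case: S T => [S Str] [T Ttr] /= pS pT; apply: eq_exist.
apply: funext => s; have := pS s; rewrite (pT s) /=.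
by case: asboolP; case: asboolP => //= a b _; apply: propext.
Qed.

Lemma tree_name_surjective T : exists p, tree_name p T.
Proof.
exists (fun n => `[< exists2 s, sval T s & seq_code s = n >] : nat) => s.
congr (nat_of_bool _); apply: asbool_equiv_eq; split; last by exists s.
by case=> t Tt /seq_code_inj <-.
Qed.

Definition tree_space : repSpace :=
  RepSpace tree_name_functional tree_name_surjective.

Definition body (T : tree) : set baire :=
  [set x | forall n, sval T (mkseq x n)].

Definition closed_set : Type := {C : set baire | closed C}.

Definition closed_name (p : baire) (C : closed_set) : Prop :=
  exists2 T, tree_name p T & body T = sval C.

Lemma closed_name_functional p C D :
  closed_name p C -> closed_name p D -> C = D.
Proof.
case: C D => [C Ccl] [D Dcl] [S pS /= SC] [T pT /= TD]; apply: eq_exist.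
by rewrite -SC -TD (tree_name_functional pS pT).
Qed.

Lemma baire_cvg (u : nat -> baire) (x : baire) :
  (forall i, \forall n \near \oo, u n i = x i) -> u n @[n --> \oo] --> x.
Proof.
move=> ux; apply/cvg_sup => i U [_ [[V Vo <-] Vxi] VU].
apply: (@filterS _ \oo _ _ _ _ (ux i)) => n uni; apply: VU => /=.
by rewrite uni.
Qed.

Lemma closed_name_surjective C : exists p, closed_name p C.
Proof.
case: C => C Ccl.
pose P : set (seq nat) := [set s | exists2 x, C x & s = mkseq x (size s)].
have Ptree : is_tree P.
  move=> s t /prefixP[r ->] [x Cx]; rewrite size_cat /mkseq iotaD map_cat => /eqP.
  by rewrite eqseq_cat ?size_mkseq// => /andP[/eqP sE _]; exists x.
have [p pP] := tree_name_surjective (exist _ P Ptree).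
exists p, (exist _ P Ptree) => //=.
apply/seteqP; split=> x /= xP; last by move=> n; exists x; rewrite ?size_mkseq.
have /choice[u uP] : forall n, exists y : baire, C y /\ mkseq x n = mkseq y n.
  by move=> n; have [y Cy] := xP n; rewrite size_mkseq => xy; exists y.
suff ux : u n @[n --> \oo] --> x.
  have uC : \forall n \near \oo, C (u n) by apply: nearW => n; case: (uP n).
  exact: (closed_cvg C Ccl uC x ux).
apply: baire_cvg => i; exists i.+1 => // n /= ni; have [_] := uP n.
by move=> /(congr1 (fun s => nth 0 s i)); rewrite !nth_mkseq.
Qed.

Definition closed_space : repSpace :=
  RepSpace closed_name_functional closed_name_surjective.

Definition well_founded_tree (T : tree) : Prop := body T = set0.

Definition WF : problem tree_space bool_space :=
  fun T => [set b | b = `[< well_founded_tree T >]].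

Definition perfect_tree (T : tree) : Prop :=
  forall s, sval T s -> exists t u,
    [/\ sval T t, sval T u, prefix s t, prefix s u &
        ~~ prefix t u && ~~ prefix u t].

Definition subtree (S T : tree) : Prop := sval S `<=` sval T.

Definition PK : problem tree_space tree_space :=
  fun T => [set P | [/\ subtree P T, perfect_tree P &
    forall S, subtree S T -> perfect_tree S -> subtree S P]].

(* The Cantor-Bendixson theorem says that this relation is a function. *)
Definition PK_baire : problem closed_space closed_space :=
  fun A => [set P | [/\ sval P `<=` sval A, perfect_set (sval P) &
    countable (sval A `\` sval P)]].

Definition lim_baire : problem (seq_space baire_space) baire_space :=
  fun u => [set x : baire | (u : nat -> baire) n @[n --> \oo] --> x].

(* Main.v *)
(* For a tree T and a node s, the perfect subtrees of T containing s, together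
   with a choice of two incomparable extensions for each of their nodes, are
   the paths of a tree computed from T and s. So the perfect kernel is computed
   node by node from well-foundedness queries. Conversely, inserting zeros
   freely into the paths of T_i, and prepending i, gives a tree in which T_i is
   ill-founded iff [:: i] is in the kernel, iff i 0 0 0 ... is a path of the
   kernel; on a tree representing the kernel as a closed set, the latter is a
   limit of decidable conditions.

   A closed set has names containing any prescribed finite tree. Hence if WF
   were reducible to PK_baire, well-foundedness of T would be equivalent to the
   existence of a perfect subtree S of the computed tree such that no tree
   containing S is ever taken for an ill-foundedness answer: a Sigma^1_1
   condition. Running that condition as a tree on its own characteristic
   function gives a tree which is ill-founded iff it is well-founded. *)
From mathcomp Require Import all_boot mathcomp_extra boolp classical_sets.
From mathcomp Require Import cardinality topology.
From Stdlib Require Cantor.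
Require Import Defs.

Set Implicit Arguments.
Unset Strict Implicit.
Unset Printing Implicit Defensive.

Local Open Scope classical_set_scope.

Arguments Cantor.to_nat : simpl never.
Arguments Cantor.of_nat : simpl never.

(** * Computability *)

Lemma npairK a b : Cantor.of_nat (npair a b) = (a, b).
Proof. exact: Cantor.cancel_of_to. Qed.

Lemma nunpairK n : npair (nfst n) (nsnd n) = n.
Proof. by rewrite -surjective_pairing Cantor.cancel_to_of. Qed.

(** The trace [h] of intermediate values replaces the nested fixpoint, so that inductions on
    programs meet only finitely many evaluations of [a] and [b]. *)
Lemma eval_prec p a b n m : eval p (Prec a b) n m <->
  exists2 h : nat -> nat, eval p a (nfst n) (h 0) /\ h (nsnd n) = m &
    forall k, k < nsnd n ->
      eval p b (npair (nfst n) (npair k (h k))) (h k.+1).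
Proof.
rewrite /=; move: (nfst n) (nsnd n) => x k; elim: k m => [|k IH] m.
  by split=> [am|[h [h0 <-] _]//]; exists (fun=> m).
split=> [[s /IH[h [h0 <-] hS] bm]|[h [h0 <-] hS]].
  exists (fun i => if i == k.+1 then m else h i).
    by rewrite eqxx.
  move=> i; rewrite ltnS leq_eqVlt eqSS => /predU1P[->|ik].
    by rewrite eqxx ltn_eqF.
  by rewrite !ltn_eqF ?ltnS// ?(ltnW ik)//; exact: hS.
exists (h k); last exact: hS.
by apply/IH; exists h => // i ik; apply: hS; exact: ltnW.
Qed.

Definition agree (k : nat) (p q : baire) : Prop := forall i, i < k -> p i = q i.

Lemma agree_le k l p q : k <= l -> agree l p q -> agree k p q.
Proof. by move=> kl pq i ik; apply: pq; exact: leq_trans kl. Qed.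

Lemma agree_trans k p q r : agree k p q -> agree k q r -> agree k p r.
Proof. by move=> pq qr i ik; rewrite pq// qr. Qed.

Lemma bounded_choice (P : nat -> nat -> Prop) m :
  (forall i k l, k <= l -> P i k -> P i l) ->
  (forall i, i < m -> exists k, P i k) ->
  exists k, forall i, i < m -> P i k.
Proof.
move=> Ple; elim: m => [|m IH] Pm; first by exists 0.
have [|k kP] := IH; first by move=> i im; apply: Pm; exact: ltnW.
have [l lP] := Pm m (leqnn _).
exists (maxn k l) => i; rewrite ltnS leq_eqVlt => /predU1P[->|im].
  exact: Ple (leq_maxr _ _) lP.
exact: Ple (leq_maxl _ _) (kP i im).
Qed.

(** A halting computation consults only finitely many oracle values. For [Prec] and [Mu],
    [bounded_choice] merges the bounds of all rounds into one. *)
Lemma eval_continuous p e n m : eval p e n m ->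
  exists k, forall q, agree k p q -> eval q e n m.
Proof.
elim: e n m => [||||| a IHa b IHb | a IHa b IHb | a IHa b IHb | a IHa] n m.
- by move=> /= mE; exists 0 => q _.
- by move=> /= mE; exists 0 => q _.
- by move=> /= mE; exists 0 => q _.
- by move=> /= mE; exists 0 => q _.
- by move=> /= ->; exists n.+1 => q pq; exact: pq.
- move=> /= [x [y [/IHa[k kP] /IHb[l lP] ->]]]; exists (maxn k l) => q pq.
  exists x, y; split=> //.
    by apply: kP; apply: agree_le pq; exact: leq_maxl.
  by apply: lP; apply: agree_le pq; exact: leq_maxr.
- move=> /= [x /IHb[k kP] /IHa[l lP]]; exists (maxn k l) => q pq; exists x.
    by apply: kP; apply: agree_le pq; exact: leq_maxl.
  by apply: lP; apply: agree_le pq; exact: leq_maxr.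
- move=> /eval_prec[h [/IHa[k kP] hm] hS].
  have [l lP] : exists l, forall i, i < nsnd n -> forall q, agree l p q ->
      eval q b (npair (nfst n) (npair i (h i))) (h i.+1).
    apply: (@bounded_choice (fun i l => forall q, agree l p q ->
      eval q b (npair (nfst n) (npair i (h i))) (h i.+1))).
      by move=> i k' l kl kP' q pq; apply: kP'; exact: agree_le pq.
    by move=> i /hS /IHb.
  exists (maxn k l) => q pq; apply/eval_prec; exists h.
    by split=> //; apply: kP; apply: agree_le pq; exact: leq_maxl.
  by move=> i im; apply: lP => //; apply: agree_le pq; exact: leq_maxr.
- move=> /= [/IHa[k kP] hS].
  have [l lP] : exists l, forall i, i < m -> forall q, agree l p q ->
      exists v, eval q a (npair n i) v.+1.
    apply: (@bounded_choice (fun i l => forall q, agree l p q ->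
      exists v, eval q a (npair n i) v.+1)).
      by move=> i k' l kl kP' q pq; apply: kP'; exact: agree_le pq.
    by move=> i /hS[v /IHa[l lP]]; exists l => q /lP; exists v.
  exists (maxn k l) => q pq; split.
    by apply: kP; apply: agree_le pq; exact: leq_maxl.
  by move=> i im; apply: lP => //; apply: agree_le pq; exact: leq_maxr.
Qed.

Lemma eval_functional p e n m m' : eval p e n m -> eval p e n m' -> m = m'.
Proof.
elim: e n m m' => [||||| a IHa b IHb | a IHa b IHb | a IHa b IHb | a IHa] n m m'.
- by move=> /= -> ->.
- by move=> /= -> ->.
- by move=> /= -> ->.
- by move=> /= -> ->.
- by move=> /= -> ->.
- move=> /= [x [y [ax bx ->]]] [x' [y' [ax' bx' ->]]].
  by rewrite (IHa _ _ _ ax ax') (IHb _ _ _ bx bx').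
- by move=> /= [x bx ax] [y /(IHb _ _ _ bx)<-]; exact: IHa.
- move=> /= ; move: (nfst n) (nsnd n) => x k.
  elim: k m m' => [|k IH] m m'; first exact: IHa.
  by move=> [s sP bs] [t /(IH _ _ sP)<-]; exact: IHb.
- move=> /= [am mm] [am' mm']; case: (ltngtP m m') => // lt.
  + by have [v /(IHa _ _ _ am)] := mm' _ lt.
  + by have [v /(IHa _ _ _ am')] := mm _ lt.
Qed.

Definition computes (p : baire) (e : prog) (q : baire) : Prop :=
  forall n, eval p e n (q n).

Fixpoint subst_oracle (o e : prog) : prog :=
  match e with
  | Oracle => o
  | Pair a b => Pair (subst_oracle o a) (subst_oracle o b)
  | Comp a b => Comp (subst_oracle o a) (subst_oracle o b)
  | Prec a b => Prec (subst_oracle o a) (subst_oracle o b)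
  | Mu a => Mu (subst_oracle o a)
  | _ => e
  end.

Lemma eval_subst_oracle p o q e n m : computes p o q ->
  eval q e n m -> eval p (subst_oracle o e) n m.
Proof.
move=> pq.
elim: e n m => [||||| a IHa b IHb | a IHa b IHb | a IHa b IHb | a IHa] n m //.
- by move=> /= ->.
- by move=> /= [x [y [/IHa ax /IHb bx ->]]]; exists x, y.
- by move=> /= [x /IHb bx /IHa ax]; exists x.
- move=> /eval_prec[h [/IHa h0 hm] hS]; apply/eval_prec; exists h => // k kn.
  by apply: IHb; exact: hS.
- by move=> /= [/IHa am mm]; split=> // i /mm[v /IHa]; exists v.
Qed.

Lemma computes_subst_oracle p o q e r :
  computes p o q -> computes q e r -> computes p (subst_oracle o e) r.
Proof. by move=> pq qr n; exact: eval_subst_oracle pq (qr n). Qed.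

(** One program serves all oracles, and every [f p] is total. Decidable conditions are covered
    through the coercion of Booleans to 0 and 1. *)
Definition crec (f : baire -> nat -> nat) : Prop :=
  exists e, forall p n, eval p e n (f p n).

Lemma eq_crec f g : (forall p n, f p n = g p n) -> crec f -> crec g.
Proof. by move=> fg [e eP]; exists e => p n; rewrite -fg. Qed.

Lemma crec_computable (f : baire -> baire) :
  crec f -> computable (fun p => Some (f p)).
Proof. by case=> e eP; exists e => p _ [<-]. Qed.

Lemma crec_id : crec (fun _ n => n).
Proof.
exists (Pair Fst Snd) => p n /=; exists (nfst n), (nsnd n).
by rewrite nunpairK.
Qed.

Lemma crec_comp f g : crec f -> crec g -> crec (fun p n => f p (g p n)).
Proof.
by move=> [e eP] [d dP]; exists (Comp e d) => p n /=; exists (g p n).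
Qed.

Lemma crec_oracle g : crec g -> crec (fun p n => p (g p n)).
Proof. by apply: (@crec_comp (fun p n => p n)); exists Oracle. Qed.

Lemma crec_fst g : crec g -> crec (fun p n => nfst (g p n)).
Proof. by apply: (@crec_comp (fun p n => nfst n)); exists Fst. Qed.

Lemma crec_snd g : crec g -> crec (fun p n => nsnd (g p n)).
Proof. by apply: (@crec_comp (fun p n => nsnd n)); exists Snd. Qed.

Lemma crec_succ g : crec g -> crec (fun p n => (g p n).+1).
Proof. by apply: (@crec_comp (fun p n => n.+1)); exists Succ. Qed.

Lemma crec_pair f g :
  crec f -> crec g -> crec (fun p n => npair (f p n) (g p n)).
Proof.
move=> [e eP] [d dP]; exists (Pair e d) => p n /=.
by exists (f p n), (g p n).
Qed.

Lemma crec_const k : crec (fun _ _ => k).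
Proof. by elim: k => [|k IH]; [exists Zero|exact: crec_succ]. Qed.

(** The hypothesis on [h] unpacks parameter, counter and previous value in the layout that [Prec]
    passes to its step program. *)
Lemma crec_nat_rect a N (h : baire -> nat -> nat -> nat -> nat) :
  crec a -> crec N ->
  crec (fun p m => h p (nfst m) (nfst (nsnd m)) (nsnd (nsnd m))) ->
  crec (fun p n => nat_rect (fun=> nat) (a p n) (h p n) (N p n)).
Proof.
move=> ca cN [e eP].
have [d dP] := ca.
suff cF : crec (fun p m =>
    nat_rect (fun=> nat) (a p (nfst m)) (h p (nfst m)) (nsnd m)).
  have := crec_comp cF (crec_pair crec_id cN).
  by apply: eq_crec => p n; rewrite npairK.
exists (Prec d e) => p m; apply/eval_prec.
exists (nat_rect (fun=> nat) (a p (nfst m)) (h p (nfst m))) => // k _.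
by have := eP p (npair (nfst m)
  (npair k (nat_rect (fun=> nat) (a p (nfst m)) (h p (nfst m)) k)));
  rewrite !npairK.
Qed.

Lemma crec_iter g N a :
  crec (fun p m => g p (nfst m) (nsnd m)) -> crec N -> crec a ->
  crec (fun p n => iter (N p n) (g p n) (a p n)).
Proof.
move=> cg cN ca.
suff: crec (fun p n =>
    nat_rect (fun=> nat) (a p n) (fun _ r => g p n r) (N p n)).
  apply: eq_crec => p n.
  by elim: (N p n) => //= k ->.
apply: (crec_nat_rect ca cN).
have := crec_comp cg (crec_pair (crec_fst crec_id)
  (crec_snd (crec_snd crec_id))).
by apply: eq_crec => p n; rewrite npairK.
Qed.

Lemma crec_if (b : baire -> nat -> bool) f g :
  crec b -> crec f -> crec g ->
  crec (fun p n => if b p n then f p n else g p n).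
Proof.
move=> cb cf cg.
suff: crec (fun p n =>
    nat_rect (fun=> nat) (g p n) (fun _ _ => f p n) (b p n)).
  by apply: eq_crec => p n; case: (b p n).
apply: (crec_nat_rect cg cb).
exact: crec_comp cf (crec_fst crec_id).
Qed.

Lemma crec_pred f : crec f -> crec (fun p n => (f p n).-1).
Proof.
move=> cf; suff: crec (fun p n =>
    nat_rect (fun=> nat) 0 (fun k _ => k) (f p n)).
  by apply: eq_crec => p n; case: (f p n).
apply: (crec_nat_rect (crec_const 0) cf).
exact: (crec_fst (crec_snd crec_id)).
Qed.

Lemma crec_sub f g : crec f -> crec g -> crec (fun p n => f p n - g p n).
Proof.
move=> cf cg; suff: crec (fun p n => iter (g p n) predn (f p n)).
  apply: eq_crec => p n.
  by elim: (g p n) => [|k /= ->]; rewrite ?subn0// subnS.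
by apply: crec_iter => //; exact: crec_pred (crec_snd crec_id).
Qed.

Lemma crec_eq0 f : crec f -> crec (fun p n => f p n == 0).
Proof.
move=> cf; have := crec_sub (crec_const 1) cf.
by apply: eq_crec => p n; case: (f p n) => [|[]].
Qed.

Lemma crec_negb (b : baire -> nat -> bool) :
  crec b -> crec (fun p n => ~~ b p n).
Proof.
by move=> /crec_eq0; apply: eq_crec => p n;
  case: (b p n).
Qed.

Lemma crec_and (b c : baire -> nat -> bool) :
  crec b -> crec c -> crec (fun p n => b p n && c p n).
Proof.
move=> cb cc; have := crec_if cb cc (crec_const 0).
by apply: eq_crec => p n; case: (b p n).
Qed.

Lemma crec_or (b c : baire -> nat -> bool) :
  crec b -> crec c -> crec (fun p n => b p n || c p n).
Proof.
move=> cb cc; have := crec_if cb (crec_const 1) cc.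
by apply: eq_crec => p n; case: (b p n).
Qed.

Lemma crec_implb (b c : baire -> nat -> bool) :
  crec b -> crec c -> crec (fun p n => b p n ==> c p n).
Proof.
move=> cb cc; have := crec_or (crec_negb cb) cc.
by apply: eq_crec => p n; rewrite implybE.
Qed.

Lemma crec_leq f g : crec f -> crec g -> crec (fun p n => f p n <= g p n).
Proof. by move=> cf cg; exact: crec_eq0 (crec_sub cf cg). Qed.

Lemma crec_eq f g : crec f -> crec g -> crec (fun p n => f p n == g p n).
Proof.
move=> cf cg; have := crec_and (crec_leq cf cg) (crec_leq cg cf).
by apply: eq_crec => p n; rewrite -eqn_leq.
Qed.

Lemma crec_all N (b : baire -> nat -> nat -> bool) :
  crec N -> crec (fun p m => b p (nfst m) (nsnd m)) ->
  crec (fun p n => all (b p n) (iota 0 (N p n))).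
Proof.
move=> cN cb; suff: crec (fun p n =>
    nat_rect (fun=> nat) 1 (fun k r => (r != 0) && b p n k) (N p n)).
  apply: eq_crec => p n.
  elim: (N p n) => // k IH.
  by rewrite [LHS]/= IH -addn1 iotaD all_cat /= andbT; case: (all _ _).
apply: (crec_nat_rect (crec_const 1) cN).
apply: crec_and; first exact: crec_negb (crec_eq0 (crec_snd (crec_snd crec_id))).
have := crec_comp cb (crec_pair (crec_fst crec_id)
  (crec_fst (crec_snd crec_id))).
by apply: eq_crec => p n; rewrite npairK.
Qed.

Lemma crec_double f : crec f -> crec (fun p n => (f p n).*2).
Proof.
move=> cf; suff: crec (fun p n => iter (f p n) (fun r => r.+2) 0).
  by apply: eq_crec => p n; elim: (f p n) => //= k ->.
apply: crec_iter cf (crec_const 0).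
exact: crec_succ (crec_succ (crec_snd crec_id)).
Qed.

Definition evens (p : baire) : baire := fun n => p n.*2.
Definition odds (p : baire) : baire := fun n => p n.*2.+1.

Lemma evensK p q : evens (interleave p q) = p.
Proof.
by apply: funext => n; rewrite /evens /interleave odd_double doubleK.
Qed.

Lemma oddsK p q : odds (interleave p q) = q.
Proof.
apply: funext => n.
by rewrite /odds /interleave /= odd_double /= uphalf_double.
Qed.

Lemma crec_evens : crec evens.
Proof. exact: crec_oracle (crec_double crec_id). Qed.

Lemma crec_odds : crec odds.
Proof. exact: crec_oracle (crec_succ (crec_double crec_id)). Qed.

Lemma crec_odds_at g : crec g -> crec (fun p n => odds p (g p n)).
Proof. exact: (crec_comp crec_odds). Qed.

Lemma crec_odd : crec (fun _ n => odd n).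
Proof.
suff: crec (fun _ n => iter n (fun r => r == 0 : nat) 0).
  apply: eq_crec => p n.
  by elim: n => //= n ->; case: (odd n).
apply: crec_iter crec_id (crec_const 0).
exact: crec_eq0 (crec_snd crec_id).
Qed.

Lemma crec_half : crec (fun _ n => n./2).
Proof.
suff: crec (fun _ n =>
    nat_rect (fun=> nat) 0 (fun k r => if odd k then r.+1 else r) n).
  apply: eq_crec => p n.
  by elim: n => //= n ->; rewrite uphalf_half; case: (odd n).
apply: crec_nat_rect (crec_const 0) crec_id _; apply: crec_if.
- exact: crec_comp crec_odd (crec_fst (crec_snd crec_id)).
- exact: crec_succ (crec_snd (crec_snd crec_id)).
- exact: crec_snd (crec_snd crec_id).
Qed.

Lemma computes_interleave e d : exists c, forall p q r,
  computes p e q -> computes p d r -> computes p c (interleave q r).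
Proof.
have [b bP] := crec_pair crec_half crec_odd.
(* The parity is used as a recursion counter: at 0 the base [e] runs, at 1 the step discards its
   result and runs [d]. Only totality on this oracle [p] is required. *)
exists (Comp (Prec e (Comp d Fst)) b) => p q r pq pr n.
exists (npair n./2 (nat_of_bool (odd n))) => //; rewrite /= npairK /interleave.
case: (odd n) => /=; last exact: pq.
by exists (q n./2) => //; exists n./2; rewrite ?npairK.
Qed.

(** * Weihrauch reducibility *)

Lemma weihrauch_le_refl (X Y : repSpace) (f : problem X Y) : weihrauch_le f f.
Proof.
exists (fun p => Some p), (fun s => Some (odds s)); split.
- exact: crec_computable (crec_oracle crec_id).
- exact: crec_computable crec_odds.
- move=> p x px fx; exists p, x; split=> // q y qy fxy.
  by exists q, y; rewrite oddsK.
Qed.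

Lemma weihrauch_le_trans (X Y Z W U V : repSpace) (f : problem X Y)
    (g : problem Z W) (h : problem U V) :
  weihrauch_le f g -> weihrauch_le g h -> weihrauch_le f h.
Proof.
move=> [F1 [P1 [[eF1 F1P] [eP1 P1P] fg]]] [F2 [P2 [[eF2 F2P] [eP2 P2P] gh]]].
(* The intermediate name [p] is recomputed from the original input, since [P2] expects it next to
   the answer. *)
pose P s := if F1 (evens s) is Some p then
  if P2 (interleave p (odds s)) is Some q then P1 (interleave (evens s) q)
  else None else None.
exists (fun p => if F1 p is Some q then F2 q else None), P; split.
- exists (subst_oracle eF1 eF2) => p r; case F1p: (F1 p) => [q|//] F2q.
  exact: computes_subst_oracle (F1P _ _ F1p) (F2P _ _ F2q).
- have [ev evP] := crec_evens; have [od odP] := crec_odds.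
  have [c cP] := computes_interleave (subst_oracle ev eF1) od.
  have [d dP] := computes_interleave ev (subst_oracle c eP2).
  exists (subst_oracle d eP1) => s r; rewrite /P.
  case F1s: (F1 _) => [p|//]; case P2s: (P2 _) => [q|//] P1s.
  apply: computes_subst_oracle (P1P _ _ P1s).
  apply: dP; first exact: evP.
  apply: computes_subst_oracle (P2P _ _ P2s).
  apply: cP; last exact: odP.
  exact: computes_subst_oracle (evP s) (F1P _ _ F1s).
- move=> p x px fx; have [p' [z [F1p p'z gz fgx]]] := fg p x px fx.
  have [p'' [u [F2p p''u hu ghz]]] := gh p' z p'z gz.
  exists p'', u; split=> //; first by rewrite F1p.
  move=> q v qv huv; have [q' [w [P2q q'w gzw]]] := ghz q v qv huv.
  have [r [y [P1q ry fxy]]] := fgx q' w q'w gzw.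
  by exists r, y; rewrite /P evensK oddsK F1p P2q.
Qed.

(** * Codes of finite sequences *)

(** A nonzero code is the successor of a pair. At 0 both projections give 0, which matches [head 0]
    and [behead] on the empty sequence. *)
Definition chead (c : nat) : nat := nfst c.-1.
Definition ctail (c : nat) : nat := nsnd c.-1.
Definition cnth (c i : nat) : nat := chead (iter i ctail c).
Definition cin (c i : nat) : bool := iter i ctail c != 0.

Lemma chead_code s : chead (seq_code s) = head 0 s.
Proof. by case: s => [|a s] //; rewrite /chead /= npairK. Qed.

Lemma ctail_code s : ctail (seq_code s) = seq_code (behead s).
Proof. by case: s => [|a s] //; rewrite /ctail /= npairK. Qed.

Lemma iter_ctail s i : iter i ctail (seq_code s) = seq_code (drop i s).
Proof.
elim: i => [|i IH]; first by rewrite drop0.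
by rewrite /= IH ctail_code -drop1 drop_drop.
Qed.

Lemma cnth_code s i : cnth (seq_code s) i = nth 0 s i.
Proof. by rewrite /cnth iter_ctail chead_code -nth0 nth_drop addn0. Qed.

Lemma cin_code s i : cin (seq_code s) i = (i < size s).
Proof.
rewrite /cin iter_ctail ltnNge; congr (~~ _).
by rewrite -subn_eq0 -size_drop; case: (drop i s).
Qed.

Lemma npair_ge2 a b : b <= npair a b.
Proof.
have /leP := Cantor.to_nat_non_decreasing a b.
by apply: leq_trans; exact: leq_addr.
Qed.

(** This lets a code serve as the bound in searches over the positions of its sequence. *)
Lemma size_code s : size s <= seq_code s.
Proof.
elim: s => //= a s IH; rewrite ltnS; apply: leq_trans IH _.
exact: npair_ge2.
Qed.

Definition cprefix (c d : nat) : bool :=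
  all (fun i => cin c i ==> cin d i && (cnth c i == cnth d i)) (iota 0 c).

Lemma cprefix_code s t : cprefix (seq_code s) (seq_code t) = prefix s t.
Proof.
apply/allP/prefixP => [st|[r ->] i _]; last first.
  rewrite !cin_code !cnth_code size_cat nth_cat; apply/implyP => is_.
  by rewrite is_ eqxx ltn_addr.
have {}st i : i < size s -> i < size t /\ nth 0 s i = nth 0 t i.
  move=> is_; have := st i; rewrite mem_iota /= !cin_code !cnth_code is_ /=.
  by case/(_ (leq_trans is_ (size_code s)))/andP => -> /eqP.
exists (drop (size s) t); rewrite -{1}(cat_take_drop (size s) t); congr (_ ++ _).
have st_size : size s <= size t.
  by case: (posnP (size s)) => [->//|s0]; rewrite -(prednK s0);
    apply: (st _ _).1; rewrite prednK.
apply: (@eq_from_nth _ 0) => [|i].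
  by rewrite size_takel.
rewrite size_takel// => is_; rewrite nth_take//.
by have [_ ->] := st i is_.
Qed.

(* The recursion runs from the last entry of the list to the first. *)
Definition cstrip (c : nat) : nat :=
  nat_rect (fun=> nat) 0 (fun k r =>
    if cnth c (c - k.+1) == 0 then r else (npair (cnth c (c - k.+1)).-1 r).+1) c.

(** Zeros are padding, and an entry [a.+1] stands for the entry [a] of the original sequence. *)
Definition strip (s : seq nat) : seq nat := [seq a.-1 | a <- s & a != 0].

Lemma strip_cat s t : strip (s ++ t) = strip s ++ strip t.
Proof. by rewrite /strip filter_cat map_cat. Qed.

Lemma cstrip_code s : cstrip (seq_code s) = seq_code (strip s).
Proof.
set c := seq_code s.
(* After [k] rounds the positions from [c - k] on are processed; those beyond the length read as 0
   and are skipped. *)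
suff F k : k <= c -> nat_rect (fun=> nat) 0 (fun k r =>
    if cnth c (c - k.+1) == 0 then r else (npair (cnth c (c - k.+1)).-1 r).+1) k
    = seq_code (strip (drop (c - k) s)).
  by rewrite /cstrip F// subnn drop0.
elim: k => [|k IH] kc; first by rewrite subn0 drop_oversize// size_code.
rewrite [LHS]/= IH 1?ltnW// cnth_code.
have -> : c - k = (c - k.+1).+1 by rewrite -subSn.
case: (ltnP (c - k.+1) (size s)) => cs.
  by rewrite [in RHS](drop_nth 0 cs) /strip /=; case: eqP.
rewrite nth_default//= drop_oversize; last exact: leqW.
by rewrite drop_oversize.
Qed.

Lemma crec_ctail_iter : crec (fun _ m => iter (nsnd m) ctail (nfst m)).
Proof.
apply: crec_iter (crec_snd crec_id) (crec_fst crec_id).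
exact: crec_snd (crec_pred (crec_snd crec_id)).
Qed.

Lemma crec_cin f g : crec f -> crec g -> crec (fun p n => cin (f p n) (g p n)).
Proof.
move=> cf cg; apply/crec_negb/crec_eq0.
apply: eq_crec (crec_comp crec_ctail_iter (crec_pair cf cg)) => p n.
by rewrite npairK.
Qed.

Lemma crec_cnth f g :
  crec f -> crec g -> crec (fun p n => cnth (f p n) (g p n)).
Proof.
move=> cf cg; apply/crec_fst/crec_pred.
apply: eq_crec (crec_comp crec_ctail_iter (crec_pair cf cg)) => p n.
by rewrite npairK.
Qed.

Lemma crec_cprefix f g :
  crec f -> crec g -> crec (fun p n => cprefix (f p n) (g p n)).
Proof.
move=> cf cg; have: crec (fun _ n => cprefix (nfst n) (nsnd n)).
  apply: crec_all (crec_fst crec_id) _.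
  have c1 : crec (fun _ m => nfst (nfst m)) := crec_fst (crec_fst crec_id).
  have c2 : crec (fun _ m => nsnd (nfst m)) := crec_snd (crec_fst crec_id).
  have ci : crec (fun _ m => nsnd m) := crec_snd crec_id.
  apply: crec_implb (crec_cin c1 ci) (crec_and (crec_cin c2 ci) _).
  exact: crec_eq (crec_cnth c1 ci) (crec_cnth c2 ci).
move=> /crec_comp /(_ (crec_pair cf cg)); apply: eq_crec => p n.
by rewrite npairK.
Qed.

(* Purely syntactic, so that no definition is unfolded. *)
Ltac crec := repeat
  match goal with
  | |- crec (fun _ n => n) => exact: crec_id
  | |- crec (fun _ _ => ?k) => exact: (crec_const k)
  | |- crec (fun p n => p (@?g p n)) => apply: (@crec_oracle g)
  | |- crec (fun p n => (Cantor.of_nat (@?g p n)).1) => apply: (@crec_fst g)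
  | |- crec (fun p n => (Cantor.of_nat (@?g p n)).2) => apply: (@crec_snd g)
  | |- crec (fun p n => (@?g p n).+1) => apply: (@crec_succ g)
  | |- crec (fun p n => (@?g p n).-1) => apply: (@crec_pred g)
  | |- crec (fun p n => npair (@?f p n) (@?g p n)) => apply: (@crec_pair f g)
  | |- crec (fun p n => @?f p n - @?g p n) => apply: (@crec_sub f g)
  | |- crec (fun p n => nat_of_bool (@?f p n == 0)) => apply: (@crec_eq0 f)
  | |- crec (fun p n => nat_of_bool (@?f p n == @?g p n)) =>
      apply: (@crec_eq f g)
  | |- crec (fun p n => nat_of_bool (~~ @?b p n)) => apply: (@crec_negb b)
  | |- crec (fun p n => nat_of_bool (@?b p n && @?c p n)) =>
      apply: (@crec_and b c)
  | |- crec (fun p n => nat_of_bool (@?b p n ==> @?c p n)) =>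
      apply: (@crec_implb b c)
  | |- crec (fun p n => cnth (@?f p n) (@?g p n)) => apply: (@crec_cnth f g)
  | |- crec (fun p n => nat_of_bool (cin (@?f p n) (@?g p n))) =>
      apply: (@crec_cin f g)
  | |- crec (fun p n => nat_of_bool (cprefix (@?f p n) (@?g p n))) =>
      apply: (@crec_cprefix f g)
  | |- crec (fun p n => odds p (@?g p n)) => apply: (@crec_odds_at g)
  end.

Lemma crec_cstrip : crec (fun _ n => cstrip n).
Proof. by apply: crec_nat_rect; crec; apply: crec_if; crec. Qed.

(** * Perfect kernels *)

Lemma eq_mkseq (x y : baire) n : mkseq x n = mkseq y n <-> agree n x y.
Proof.
split=> [xy i im|xy].
  by have := congr1 (fun s => nth 0 s i) xy; rewrite !nth_mkseq.
by apply: (@eq_from_nth _ 0) => [|i]; rewrite !size_mkseq// => im;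
  rewrite !nth_mkseq// xy.
Qed.

Lemma prefix_mkseq (x : baire) m n : m <= n -> prefix (mkseq x m) (mkseq x n).
Proof.
move=> /subnKC <-; rewrite /mkseq iotaD map_cat; apply/prefixP.
by exists [seq x i | i <- iota (0 + m) (n - m)].
Qed.

Lemma prefix_take (s t : seq nat) : prefix s t -> s = take (size s) t.
Proof. by move=> /prefixP[r ->]; rewrite take_size_cat. Qed.

Lemma take_mkseq (x : baire) m n : m <= n -> take m (mkseq x n) = mkseq x m.
Proof.
by move=> /(prefix_mkseq x)/prefix_take ->; rewrite size_mkseq.
Qed.

Lemma prefix_mkseqE (s : seq nat) (x : baire) n :
  prefix s (mkseq x n) -> s = mkseq x (size s).
Proof.
move=> sx; rewrite {1}(prefix_take sx) take_mkseq//.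
by have := size_prefix sx; rewrite size_mkseq.
Qed.

Lemma mkseq_incomparable (x y : baire) n : mkseq x n <> mkseq y n ->
  ~~ prefix (mkseq x n) (mkseq y n) && ~~ prefix (mkseq y n) (mkseq x n).
Proof.
move=> xy; apply/andP; split; apply/negP => /prefix_mkseqE; rewrite size_mkseq//.
by move/esym.
Qed.

Lemma nbhs_agree (x : baire) n : nbhs x [set y | agree n x y].
Proof.
elim: n => [|n IH]; first by apply: (@filterS _ (nbhs x) _ setT) filterT => y _.
have xn : nbhs x [set y : baire | y n = x n].
  apply: open_nbhs_nbhs; split=> //.
  suff : @open baire (proj n @^-1` [set x n]) by [].
  by apply: open_comp; [move=> + _; exact: proj_continuous|exact: discrete_open].
apply: filterS2 IH xn => y xy yn i; rewrite ltnS leq_eqVlt => /predU1P[->|]//.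
exact: xy.
Qed.

Lemma agree_limit_point (E : set baire) (x : baire) :
  (forall n, exists y, [/\ y <> x, E y & agree n x y]) -> limit_point E x.
Proof.
move=> /choice[u uP] V Vx.
have ux : u n @[n --> \oo] --> x.
  apply: baire_cvg => i; exists i.+1 => // n /= ni.
  by have [_ _ /(_ i ni)] := uP n.
have [n _ /(_ n (leqnn n)) Vun] := ux _ Vx.
by exists (u n); have [/eqP unx Eun _] := uP n.
Qed.

Lemma body_closed T : closed (body T).
Proof.
move=> x clx n; have [y [Ty xy]] := clx _ (nbhs_agree x n).
by rewrite (iffRL (eq_mkseq x y n) xy).
Qed.

(** Dependent choice with a relation that varies with the stage, as diagonal arguments require. *)
Lemma dependent_chain (S : set (seq nat)) (R : nat -> rel (seq nat)) s :
  S s -> (forall n s, S s -> exists t, S t /\ R n s t) ->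
  exists t : nat -> seq nat,
    t 0 = s /\ forall n, S (t n) /\ R n (t n) (t n.+1).
Proof.
move=> Ss SR.
have /choice[f fP] : forall ns : nat * seq nat,
    exists t, S ns.2 -> S t /\ R ns.1 ns.2 t.
  move=> [n u]; have [/(SR n)[t tP]|nSu] := pselect (S u); first by exists t.
  by exists [::].
pose t := nat_rect (fun=> seq nat) s (fun n u => f (n, u)).
have St n : S (t n) by elim: n => //= n /(fP (n, _))[].
exists t; split=> // n; split; first exact: St.
by have [] := fP (n, t n) (St n).
Qed.

(** The length of [t n] is at least [n], so entry [i] of the path can be read off [t i.+1]. *)
Lemma chain_path (t : nat -> seq nat) :
  (forall n, prefix (t n) (t n.+1) && (size (t n) < size (t n.+1))) ->
  exists x : baire, forall n, t n = mkseq x (size (t n)).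
Proof.
move=> tP.
have tle m n : m <= n -> prefix (t m) (t n).
  move=> /subnKC <-; elim: (n - m) => [|k IH]; first by rewrite addn0 prefix_refl.
  by rewrite addnS; apply: prefix_trans IH _; have /andP[] := tP (m + k).
have nt n : n <= size (t n).
  by elim: n => // n IH; have /andP[_] := tP n; exact: leq_ltn_trans.
exists (fun i => nth 0 (t i.+1) i) => n.
apply: (@eq_from_nth _ 0) => [|i itn]; rewrite ?size_mkseq// nth_mkseq//.
have [/tle/prefixP[r ->]|/ltnW/tle/prefixP[r tE]] := leqP n i.+1.
  by rewrite nth_cat itn.
by rewrite tE nth_cat nt.
Qed.

Lemma chain_body (T : tree) (t : nat -> seq nat) :
  (forall n, sval T (t n)) ->
  (forall n, prefix (t n) (t n.+1) && (size (t n) < size (t n.+1))) ->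
  exists2 x, body T x & forall n, t n = mkseq x (size (t n)).
Proof.
move=> Tt tP; have [x xP] := chain_path tP; exists x => // n.
have nt : n <= size (t n).
  by elim: n => // n IH; have /andP[_] := tP n; exact: leq_ltn_trans.
by apply: (svalP T) (Tt n); rewrite xP; exact: prefix_mkseq.
Qed.

(** Two initial segments of [y] are comparable, so one of two incomparable extensions leaves [y];
    incomparability also makes it longer than [s]. *)
Lemma perfect_step (S : tree) s (y : baire) : perfect_tree S -> sval S s ->
  exists t, sval S t /\
    [&& prefix s t, size s < size t & t != mkseq y (size t)].
Proof.
move=> Sp /Sp[t [u [St Su st su /andP[ntu nut]]]].
have ext v w : prefix s v -> prefix s w -> ~~ prefix v w -> size s < size v.
  move=> /prefixP[[|a r] ->] sw; rewrite ?cats0 ?sw// => _.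
  by rewrite size_cat /= addnS ltnS leq_addr.
have [tE|tE] := eqVneq t (mkseq y (size t)); last first.
  by exists t; split=> //; rewrite st tE (ext _ u).
exists u; split=> //; rewrite su (ext _ t)//=; apply/eqP => uE.
case/orP: (leq_total (size t) (size u)) => tu.
  by case/negP: ntu; rewrite tE uE; exact: prefix_mkseq.
by case/negP: nut; rewrite tE uE; exact: prefix_mkseq.
Qed.

(** Cantor's diagonal argument: the extension chosen at stage [n] leaves [d n]. *)
Lemma perfect_path (S : tree) s (d : nat -> baire) :
  perfect_tree S -> sval S s ->
  exists x, [/\ body S x, mkseq x (size s) = s & forall n, x <> d n].
Proof.
move=> Sp Ss.
have [t [t0 tP]] := dependent_chain Ss (fun n u Su => perfect_step (d n) Sp Su).
have [||x Sx xP] := @chain_body S t.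
- by move=> n; have [] := tP n.
- by move=> n; have [_ /and3P[-> ->]] := tP n.
exists x; split=> // [|n xd]; first by rewrite -t0 -xP.
by have [_ /and3P[_ _]] := tP n; rewrite {1}xP xd eqxx.
Qed.

(** * Cones, condensation points and countability *)

Definition cone (T : tree) (s : seq nat) : set baire :=
  [set x | body T x /\ mkseq x (size s) = s].

Lemma perfect_uncountable (S : tree) s : perfect_tree S -> sval S s ->
  ~ countable (cone S s).
Proof.
move=> Sp Ss /countable_injP[f finj].
(* The injection [f] is inverted to enumerate the cone; numbers outside its range get the zero
   sequence. *)
pose d n : baire := xget (fun=> 0) [set x | cone S s x /\ f x = n].
have [x [Sx xs xd]] := perfect_path d Sp Ss.
have Cx : cone S s x by [].
apply: (xd (f x)); rewrite /d; case: xgetP => [y _ [Cy fyx]|/(_ x)]; last first.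
  by case.
by apply: finj; rewrite ?inE// fyx.
Qed.

Lemma body_perfect (S : tree) : perfect_tree S -> perfect_set (body S).
Proof.
move=> Sp; split; first exact: body_closed.
apply/seteqP; split=> x Sx.
  by apply: (body_closed (T := S)); exact: subset_limit_point.
apply: agree_limit_point => n.
have [y [Sy xy yx]] := perfect_path (fun=> x) Sp (Sx n).
exists y; split=> //; first exact: (yx 0).
by apply/eq_mkseq; rewrite size_mkseq in xy.
Qed.

Lemma cone_prefix T s t : prefix s t -> cone T t `<=` cone T s.
Proof.
move=> st x [Tx xt]; split=> //; rewrite -xt in st.
exact/esym/(prefix_mkseqE st).
Qed.

Lemma uncountable_is_tree T : is_tree [set s | ~ countable (cone T s)].
Proof.
move=> s t st /= nct cs; apply: nct.
exact: sub_countable (subset_card_le (cone_prefix st)) cs.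
Qed.

Definition condensation_tree (T : tree) : tree :=
  exist _ _ (@uncountable_is_tree T).

Lemma countable_bigcup_cone (T : tree) (D : set (seq nat)) :
  (forall s, D s -> countable (cone T s)) ->
  countable (\bigcup_(s in D) cone T s).
Proof. by move=> cD; apply: bigcup_countable. Qed.

(** If [s] did not split, at most one path through [s] would avoid all countable cones. The
    remaining paths lie in countably many countable cones, so the cone of [s] would be countable. *)
Lemma condensation_perfect T : perfect_tree (condensation_tree T).
Proof.
move=> s /= ncs; apply: contrapT => nsplit; apply: ncs.
pose C := condensation_tree T.
have : cone T s `<=` (cone T s `\` \bigcup_(u in ~` sval C) cone T u) `|`
    \bigcup_(u in ~` sval C) cone T u.
  by move=> x sx; have [] := pselect ((\bigcup_(u in ~` sval C) cone T u) x);
    [right|left].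
move=> /subset_card_le/sub_countable; apply; rewrite -bigcup2E.
apply: bigcup_countable => // -[|[|n]] _ /=; last exact: countable0.
(* A constant map is injective here: two distinct paths avoiding the countable cones would yield a
   splitting of [s]. *)
- apply/countable_injP; exists (fun=> 0) => x y /set_mem[[Tx xs] xC].
  move=> /set_mem[[Ty ys] yC] _; apply: funext => i; apply: contrapT => xyi.
  have mkC z : body T z -> ~ (\bigcup_(u in ~` sval C) cone T u) z ->
      forall n, sval C (mkseq z n).
    move=> Tz nz n; apply: contrapT => nC; apply: nz; exists (mkseq z n) => //.
    by split=> //; rewrite size_mkseq.
  apply: nsplit; pose n := maxn (size s) i.+1.
  exists (mkseq x n), (mkseq y n); split; try exact: mkC.
  - by rewrite -xs; apply: prefix_mkseq; exact: leq_maxl.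
  - by rewrite -ys; apply: prefix_mkseq; exact: leq_maxl.
  - apply: mkseq_incomparable => /eq_mkseq/(_ i) xy; apply: xyi; apply: xy.
    exact: leq_maxr.
- by apply: countable_bigcup_cone => u /= /contrapT.
Qed.

Lemma cone_nonempty T s : cone T s !=set0 -> sval T s.
Proof. by case=> x [Tx <-]. Qed.

(** * Perfect kernels of trees and of closed sets *)

Lemma kernel_is_tree T :
  is_tree [set s | exists S, [/\ subtree S T, perfect_tree S & sval S s]].
Proof.
move=> s t st [S [ST Sp Stt]]; exists S; split=> //.
exact: (svalP S) Stt.
Qed.

Definition kernel (T : tree) : tree := exist _ _ (@kernel_is_tree T).

Lemma kernel_sub T : subtree (kernel T) T.
Proof. by move=> s [S [ST _ Ss]]; exact: ST. Qed.

Lemma kernel_perfect T : perfect_tree (kernel T).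
Proof.
move=> s [S [ST Sp /[dup] Ss /Sp[t [u [St Su st su tu]]]]].
by exists t, u; split=> //; exists S.
Qed.

Lemma sub_kernel S T : subtree S T -> perfect_tree S -> subtree S (kernel T).
Proof. by move=> ST Sp s Ss; exists S. Qed.

Lemma PK_kernel T : PK T (kernel T).
Proof.
by split; [exact: kernel_sub|exact: kernel_perfect|move=> S; exact: sub_kernel].
Qed.

Lemma PK_unique T P : PK T P -> forall s, sval P s <-> sval (kernel T) s.
Proof.
move=> [PT Pp Pmax] s; split; first exact: sub_kernel.
by apply: Pmax; [exact: kernel_sub|exact: kernel_perfect].
Qed.

(** A path outside the kernel has a prefix outside the perfect subtree [condensation_tree T], hence
    lies in one of countably many countable cones. *)
Lemma countable_body_kernel T : countable (body T `\` body (kernel T)).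
Proof.
apply: (@sub_countable _ _ _
  (\bigcup_(s in [set s | countable (cone T s)]) cone T s)); last first.
  exact: countable_bigcup_cone.
apply: subset_card_le => x [Tx].
move=> /existsNP[n nK]; exists (mkseq x n); last first.
  by split=> //; rewrite size_mkseq.
apply: contrapT => nc; apply: nK; exists (condensation_tree T); split=> //.
- move=> s /= ncs; apply: cone_nonempty; apply/set0P/eqP => s0.
  by apply: ncs; rewrite s0; exact: countable0.
- exact: condensation_perfect.
Qed.

Lemma perfect_set_is_tree (K : set baire) :
  is_tree [set s | exists2 x, K x & s = mkseq x (size s)].
Proof.
move=> s t st [x Kx tE]; exists x => //.
by rewrite tE in st; exact: prefix_mkseqE st.
Qed.

(** Cones of the kernel are uncountable and [A] minus [K] is countable, so [K] comes arbitrarily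
    close to each kernel path and, being closed, contains it. Conversely, the prefixes of points of
    [K] form a perfect subtree. *)
Lemma PK_baire_unique T (A K : closed_set) :
  body T = sval A -> PK_baire A K -> sval K = body (kernel T).
Proof.
case: K => [K Kcl] /= TA [/=]; rewrite -TA => KT [_ Kp] cK.
apply/seteqP; split=> x Kx; last first.
  have /choice[u uP] n : exists y, K y /\ agree n x y.
    apply: contrapT => nK; apply: (perfect_uncountable (@kernel_perfect T) (Kx n)).
    apply: sub_countable cK; apply: subset_card_le => y [Ty yx]; split.
      by move=> k; exact: kernel_sub.
    move=> Ky; apply: nK; exists y; split=> //.
    by apply/eq_mkseq; rewrite size_mkseq in yx.
  have ux : u n @[n --> \oo] --> x.
    apply: baire_cvg => i; exists i.+1 => // n /= ni.
    by have [_ /(_ i ni)] := uP n.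
  have uK : \forall n \near \oo, K (u n) by apply: nearW => n; case: (uP n).
  exact: (closed_cvg K Kcl uK x ux).
pose S : tree := exist _ _ (@perfect_set_is_tree K).
move=> n; exists S; split.
- by move=> s [y Ky ->]; exact: KT.
- move=> s [y Ky sE]; have Ly : limit_point K y by rewrite Kp.
  have [z [/eqP zy Kz yz]] := Ly _ (nbhs_agree y (size s)).
  have [i zyi] : exists i, z i <> y i.
    by apply: contrapT => /forallNP zy'; apply: zy; apply: funext => i;
      exact: contrapT.
  pose k := maxn (size s) i.+1; exists (mkseq z k), (mkseq y k); split.
  + by exists z; rewrite ?size_mkseq.
  + by exists y; rewrite ?size_mkseq.
  + rewrite sE (iffRL (eq_mkseq y z _) yz).
    by apply: prefix_mkseq; exact: leq_maxl.
  + by rewrite sE; apply: prefix_mkseq; exact: leq_maxl.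
  + apply: mkseq_incomparable => /eq_mkseq/(_ i) zy'; apply: zyi; apply: zy'.
    exact: leq_maxr.
- by exists x; rewrite ?size_mkseq.
Qed.

Lemma PK_baire_kernel T (A : closed_set) : body T = sval A ->
  PK_baire A (exist _ _ (@body_closed (kernel T))).
Proof.
move=> TA; split=> /=.
- by rewrite -TA => x Tx n; exact: kernel_sub.
- by apply: body_perfect; exact: kernel_perfect.
- by rewrite -TA; exact: countable_body_kernel.
Qed.

(** * Kernels from well-foundedness *)

(** Finite approximation of [perfect_code]: the guards [cin] postpone conditions on entries that the
    finite sequence has not reached. *)
Definition kernel_code (p : baire) (n c : nat) : bool :=
  all (fun i => cin c i && (cnth c i != 0) ==>
    [&& p i == 1,
        cprefix i (nfst (cnth c i).-1), cprefix i (nsnd (cnth c i).-1),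
        ~~ cprefix (nfst (cnth c i).-1) (nsnd (cnth c i).-1),
        ~~ cprefix (nsnd (cnth c i).-1) (nfst (cnth c i).-1),
        cin c (nfst (cnth c i).-1) ==> (cnth c (nfst (cnth c i).-1) != 0) &
        cin c (nsnd (cnth c i).-1) ==> (cnth c (nsnd (cnth c i).-1) != 0)])
    (iota 0 c)
  && (cin c n ==> (cnth c n != 0)).

Lemma crec_kernel_code : crec (fun p m => kernel_code p (nfst m) (nsnd m)).
Proof.
apply: crec_and; last by crec.
by apply: crec_all; crec.
Qed.

Definition split_code (i v : nat) : bool :=
  [&& cprefix i (nfst v.-1), cprefix i (nsnd v.-1),
      ~~ cprefix (nfst v.-1) (nsnd v.-1) & ~~ cprefix (nsnd v.-1) (nfst v.-1)].

Lemma kernel_codeP p n s : kernel_code p n (seq_code s) <->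
  (forall i, i < size s -> nth 0 s i != 0 ->
    [/\ (p i == 1) && split_code i (nth 0 s i),
      nfst (nth 0 s i).-1 < size s -> nth 0 s (nfst (nth 0 s i).-1) != 0 &
      nsnd (nth 0 s i).-1 < size s -> nth 0 s (nsnd (nth 0 s i).-1) != 0]) /\
  (n < size s -> nth 0 s n != 0).
Proof.
rewrite /kernel_code /split_code !cin_code !cnth_code; split.
  move=> /andP[/allP sP /implyP ns]; split=> // i is_ si.
  have := sP i; rewrite mem_iota /= (leq_trans is_ (size_code s)) => /(_ isT).
  rewrite !cin_code !cnth_code is_ si /=.
  by case/and5P=> -> -> -> -> /and3P[-> /implyP sa /implyP sb]; split.
move=> [sP /implyP ->]; rewrite andbT; apply/allP => i _.
rewrite !cin_code !cnth_code; apply/implyP => /andP[is_ si].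
have [/and5P[-> -> -> -> ->] sa sb] := sP i is_ si.
by rewrite /=; apply/andP; split; exact/implyP.
Qed.

Lemma kernel_code_is_tree p n : is_tree [set s | kernel_code p n (seq_code s)].
Proof.
move=> s t st /kernel_codeP[tP nt]; apply/kernel_codeP.
have sts := size_prefix st; have /prefixP[r tE] := st.
have nthE i : i < size s -> nth 0 t i = nth 0 s i.
  by move=> is_; rewrite tE nth_cat is_.
have lt i : i < size s -> i < size t by move=> is_; exact: leq_trans sts.
split=> [i is_ si|ns]; last by rewrite -nthE//; exact/nt/lt.
have [|sp ta tb] := tP i (lt _ is_); first by rewrite nthE.
rewrite nthE// in sp ta tb; split=> // is'.
  by rewrite -nthE//; exact/ta/lt.
by rewrite -nthE//; exact/tb/lt.
Qed.

(* Its paths describe the perfect subtrees containing the node coded by [n]: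
   an entry at [i] is zero, or it gives two incomparable extensions in the
   subtree of the node coded by [i]. *)
Definition kernel_search (p : baire) (n : nat) : tree :=
  exist _ _ (@kernel_code_is_tree p n).

(* The supports of these [x] generate the perfect subtrees of the tree [p]. *)
Definition perfect_code (p x : baire) : Prop :=
  forall i, x i != 0 -> [/\ (p i == 1) && split_code i (x i),
    x (nfst (x i).-1) != 0 & x (nsnd (x i).-1) != 0].

Lemma body_kernel_search p n (x : baire) :
  body (kernel_search p n) x <-> perfect_code p x /\ x n != 0.
Proof.
split=> [xP|[xP xn] k]; last first.
  apply/kernel_codeP; rewrite size_mkseq; split=> [i ik|nk]; last first.
    by rewrite nth_mkseq.
  rewrite (nth_mkseq _ _ ik) => /xP[sx xa xb].
  by split=> // k'; rewrite nth_mkseq.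
split=> [i xi|]; last first.
  have /kernel_codeP[_ /(_ _)] := xP n.+1.
  by rewrite size_mkseq nth_mkseq//; exact.
pose k := (i + nfst (x i).-1 + nsnd (x i).-1).+1.
have ik : i < k by rewrite ltnS -addnA leq_addr.
have ak : nfst (x i).-1 < k by rewrite ltnS addnAC leq_addl.
have bk : nsnd (x i).-1 < k by rewrite ltnS leq_addl.
have /kernel_codeP[+ _] := xP k; rewrite size_mkseq => /(_ i ik).
by rewrite !nth_mkseq// => /(_ xi)[sx /(_ ak) xa /(_ bk) xb].
Qed.

Lemma perfect_code_kernel p T : tree_name p T ->
  exists2 x, perfect_code p x &
    forall s, sval (kernel T) s <-> x (seq_code s) != 0.
Proof.
move=> pT.
(* Each kernel node receives one plus the pair of its two chosen extensions, and every other
   position receives 0. *)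
have /choice[x xP] : forall n, exists m,
    (forall t, sval (kernel T) t -> seq_code t = n -> exists u v,
      [/\ sval (kernel T) u, sval (kernel T) v,
          m = (npair (seq_code u) (seq_code v)).+1,
          prefix t u && prefix t v & ~~ prefix u v && ~~ prefix v u]) /\
    (m <> 0 -> exists2 t, sval (kernel T) t & seq_code t = n).
  move=> n; have [t <-] := seq_code_surj n.
  have [Kt|nKt] := pselect (sval (kernel T) t); last first.
    by exists 0; split=> // t' Kt' /seq_code_inj tt'; rewrite tt' in Kt'.
  have [u [v [Ku Kv tu tv uv]]] := kernel_perfect Kt.
  exists (npair (seq_code u) (seq_code v)).+1; split; last by exists t.
  by move=> t' Kt' /seq_code_inj ->; exists u, v; rewrite tu tv.
have x0 t : sval (kernel T) t -> x (seq_code t) != 0.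
  by move=> Kt; have [/(_ t Kt erefl)[u [v [_ _ -> _ _]]] _] := xP (seq_code t).
exists x => [i /eqP xi|s]; last first.
  split=> [|/eqP xs]; first exact: x0.
  by have [_ /(_ xs)[t Kt /seq_code_inj <-]] := xP (seq_code s).
have [+ /(_ xi)[t Kt ti]] := xP i.
move=> /(_ t Kt ti)[u [v [Ku Kv xiE /andP[tu tv] uv]]].
rewrite /split_code xiE /= npairK /= -ti !cprefix_code tu tv uv.
by rewrite pT asboolT ?x0//; exact: kernel_sub.
Qed.

Lemma perfect_code_sub p T x s : tree_name p T -> perfect_code p x ->
  x (seq_code s) != 0 -> sval (kernel T) s.
Proof.
move=> pT xP xs.
(* The marked nodes need not be closed under prefixes. Their closure is perfect, as each node lies
   below a marked one, which splits into two marked ones. *)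
have Strf : is_tree [set t | exists2 u, prefix t u & x (seq_code u) != 0].
  by move=> t t' tt' [u tu xu]; exists u => //; exact: prefix_trans tu.
exists (exist _ _ Strf); split=> /=.
- move=> t [u tu /xP[/andP[pu _] _ _]]; apply: (svalP T) tu _.
  by move: pu; rewrite pT; case: asboolP.
- move=> t [u tu xu]; have [/andP[_ +] xa xb] := xP _ xu.
  rewrite /split_code; set v := x (seq_code u) in xa xb *.
  have [a aE] := seq_code_surj (nfst v.-1).
  have [b bE] := seq_code_surj (nsnd v.-1).
  rewrite -aE -bE !cprefix_code => /and4P[ua ub ab ba].
  exists a, b; split; last by rewrite ab.
  + by exists a; rewrite ?prefix_refl// aE.
  + by exists b; rewrite ?prefix_refl// bE.
  + exact: prefix_trans ua.
  + exact: prefix_trans ub.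
- by exists s; rewrite ?prefix_refl.
Qed.

Lemma kernel_searchP p T s : tree_name p T ->
  sval (kernel T) s <-> ~ well_founded_tree (kernel_search p (seq_code s)).
Proof.
move=> pT; split=> [Ks|/eqP/set0P[x /body_kernel_search[xP xs]]].
  have [x xP Kx] := perfect_code_kernel pT; move=> wf.
  suff : set0 x by [].
  by rewrite -wf; apply/body_kernel_search; split=> //; exact/Kx.
exact: perfect_code_sub xP xs.
Qed.

(** * The reductions of both kernels to well-foundedness queries *)

Lemma pdom_WF (Ts : seq_space tree_space) : pdom (parallelization WF) Ts.
Proof. by exists (fun i => `[< well_founded_tree (Ts i) >]). Qed.

Definition kernel_queries (p : baire) : baire :=
  fun m => kernel_code p (nfst m) (nsnd m).

(** Answer 1 of [WF] means that no perfect subtree contains the node, hence the negation. The bit of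
    query [n] sits at position 0 of its name. *)
Definition negated_answers (s : baire) : baire :=
  fun n => (odds s (npair n 0) == 0 : nat).

Lemma computable_kernel_queries : computable (fun p => Some (kernel_queries p)).
Proof. exact: crec_computable crec_kernel_code. Qed.

Lemma computable_negated_answers :
  computable (fun s => Some (negated_answers s)).
Proof.
apply: crec_computable; apply: crec_eq0; apply: crec_odds_at.
exact: crec_pair crec_id (crec_const 0).
Qed.

Lemma name_kernel_queries p :
  @rname (seq_space tree_space) (kernel_queries p) (kernel_search p).
Proof.
by move=> i s; rewrite /proj_seq /kernel_queries npairK /= asboolb.
Qed.

Lemma name_negated_answers p T q z : tree_name p T ->
  @rname (seq_space bool_space) q z ->
  parallelization WF (kernel_search p) z ->
  tree_name (negated_answers (interleave p q)) (kernel T).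
Proof.
move=> pT qz zP s; rewrite /negated_answers oddsK.
have := qz (seq_code s); rewrite /= /bool_name /proj_seq => ->.
rewrite zP; have := kernel_searchP s pT.
case: asboolP => wf [Kn nK]; case: asboolP => // Ks; first by case: (Kn Ks).
by case: Ks; exact: nK.
Qed.

Lemma PK_le_WF : weihrauch_le PK (parallelization WF).
Proof.
exists (fun p => Some (kernel_queries p)), (fun s => Some (negated_answers s)).
split; [exact: computable_kernel_queries|exact: computable_negated_answers|].
move=> p T pT _; exists (kernel_queries p), (kernel_search p); split=> //.
- exact: name_kernel_queries.
- exact: pdom_WF.
- move=> q z qz zP; exists (negated_answers (interleave p q)), (kernel T).
  by split=> //; [exact: name_negated_answers zP|exact: PK_kernel].
Qed.

Lemma PK_baire_le_WF : weihrauch_le PK_baire (parallelization WF).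
Proof.
exists (fun p => Some (kernel_queries p)), (fun s => Some (negated_answers s)).
split; [exact: computable_kernel_queries|exact: computable_negated_answers|].
move=> p A [T pT TA] _; exists (kernel_queries p), (kernel_search p); split=> //.
- exact: name_kernel_queries.
- exact: pdom_WF.
- move=> q z qz zP; exists (negated_answers (interleave p q)).
  exists (exist _ _ (@body_closed (kernel T))); split=> //.
    by exists (kernel T) => //; exact: name_negated_answers zP.
  exact: PK_baire_kernel.
Qed.

(** * Well-foundedness from kernels *)

Lemma prefix_strip s t : prefix s t -> prefix (strip s) (strip t).
Proof. by move=> /prefixP[r ->]; rewrite strip_cat prefix_prefix. Qed.

Lemma padded_is_tree (Ts : nat -> tree) :
  is_tree [set s | if s is i :: s' then sval (Ts i) (strip s') else True].
Proof.
move=> [|i s] [|j t]//=; case: eqP => //= <- /prefix_strip.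
exact: (svalP (Ts i)).
Qed.

(* Zeros may be inserted anywhere into a path of [Ts i], so the paths through
   [:: i] are uncountably many, and accumulate at [i 0 0 0 ...], if [Ts i] is
   ill-founded; otherwise they are all eventually zero. *)
Definition padded (Ts : nat -> tree) : tree :=
  exist _ _ (@padded_is_tree Ts).

Definition spike (i : nat) : baire := fun j => if j is _.+1 then 0 else i.

Lemma mkseq_spike i n : mkseq (spike i) n.+1 = i :: nseq n 0.
Proof.
apply: (@eq_from_nth _ 0) => [|j]; rewrite size_mkseq.
  by rewrite /= size_nseq.
move=> jn; rewrite nth_mkseq//; case: j jn => //= j _.
by rewrite nth_nseq if_same.
Qed.

Lemma prefix_size_eq (s t : seq nat) : size s = size t -> prefix s t -> s = t.
Proof. by move=> st /prefix_take ->; rewrite st take_size. Qed.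

Lemma kernel_padded_ill Ts i : ~ well_founded_tree (Ts i) ->
  body (kernel (padded Ts)) (spike i).
Proof.
move=> /eqP/set0P[x Tx].
(* The perfect subtree consists of [i] followed by all paddings of prefixes of the single path
   [x]. *)
have Ptr : is_tree [set s | s = [::] \/ exists s' k,
    s = i :: s' /\ strip s' = mkseq x k].
  move=> [|j s] t st; [by left|]; case=> [tE|[s' [k [tE s'x]]]].
    by rewrite tE in st.
  right; move: st; rewrite tE /=; case: eqP => // -> /= /prefix_strip.
  by rewrite s'x => /prefix_mkseqE ss'; exists s, (size (strip s)).
have split_cons s' k : strip s' = mkseq x k ->
    exists t u, [/\ sval (exist _ _ Ptr : tree) t, sval (exist _ _ Ptr : tree) u,
      prefix (i :: s') t, prefix (i :: s') u & ~~ prefix t u && ~~ prefix u t].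
  (* A node splits by appending either a padding zero or the next entry of [x], shifted by one. *)
  move=> s'x; exists (i :: rcons s' 0), (i :: rcons s' (x k).+1); split=> /=.
  - by right; exists (rcons s' 0), k; rewrite -cats1 strip_cat cats0.
  - right; exists (rcons s' (x k).+1), k.+1; split=> //.
    by rewrite -cats1 strip_cat s'x -[k.+1]addn1 /mkseq iotaD map_cat.
  - by rewrite eqxx prefix_rcons.
  - by rewrite eqxx prefix_rcons.
  - rewrite eqxx /=; apply/andP; split; apply/negP => /prefix_size_eq.
      by rewrite !size_rcons => /(_ erefl)/eqP; rewrite eqseq_rcons andbF.
    by rewrite !size_rcons => /(_ erefl)/eqP; rewrite eqseq_rcons andbF.
suff: subtree (exist _ _ Ptr) (kernel (padded Ts)).
  move=> Pker [|n]; apply: Pker; first by left.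
  right; exists (nseq n 0), 0; split; first exact: mkseq_spike.
  by elim: n.
apply: sub_kernel.
- by move=> s /= [->//|[s' [k [-> ->]]]].
- move=> s /= [->|[s' [k [-> s'x]]]]; last exact: split_cons s'x.
  have [t [u [Pt Pu _ _ tu]]] := split_cons [::] 0 erefl.
  by exists t, u; rewrite !prefix0s.
Qed.

(** Perfectness provides extensions that contain new nonzero entries; stripping such a chain gives a
    path of [Ts i]. *)
Lemma kernel_padded_singleton Ts i : sval (kernel (padded Ts)) [:: i] ->
  ~ well_founded_tree (Ts i).
Proof.
move=> Ki wf.
pose S := [set s | sval (kernel (padded Ts)) s /\ prefix [:: i] s].
have [||t [_ tP]] := @dependent_chain S (fun _ s t =>
    prefix (behead s) (behead t) &&
      (size (strip (behead s)) < size (strip (behead t)))) [:: i].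
- by split=> //; exact: prefix_refl.
(* By the default of [nth], [y] is [s] followed by zeros, so an extension of [s] off [y] adds a
   nonzero entry. *)
- move=> _ s [Ks is_]; pose y : baire := fun j => nth 0 s j.
  have [t [Kt /and3P[st _ ty]]] := perfect_step y (@kernel_perfect _) Ks.
  exists t; split; first by split=> //; exact: prefix_trans st.
  case/prefixP: st Kt ty => r -> Kt ty; case: s is_ Ks @y Kt ty => // j s _ _ y _.
  rewrite /= prefix_prefix strip_cat !size_cat -[X in (X < _)%N]addn0 ltn_add2l.
  apply: contraNT; rewrite -leqNgt leqn0 => /nilP r0; apply/eqP.
  have {}r0 : r = nseq (size r) 0.
    by elim: r r0 => //= -[|a] r IH //= /IH{1}->.
  apply: (@eq_from_nth _ 0) => [|k]; first by rewrite size_mkseq /= size_cat.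
  rewrite /= size_cat => kr; rewrite nth_mkseq// /y -cat_cons nth_cat.
  case: ltnP => // ks.
  by rewrite r0 nth_nseq if_same nth_default.
have [||x Tx _] := @chain_body (Ts i) (fun n => strip (behead (t n))).
- move=> n; have [[/kernel_sub]] := tP n.
  by case: (t n) => //= j s Us /andP[/eqP-> _].
- by move=> n; have [_ /andP[/prefix_strip -> ->]] := tP n.
- by have : set0 x by rewrite -wf.
Qed.

Lemma kernel_paddedP Ts i :
  sval (kernel (padded Ts)) [:: i] <-> ~ well_founded_tree (Ts i).
Proof.
split=> [|/kernel_padded_ill /(_ 1)]; first exact: kernel_padded_singleton.
by rewrite mkseq_spike.
Qed.

Lemma body_kernel_paddedP Ts i :
  body (kernel (padded Ts)) (spike i) <-> ~ well_founded_tree (Ts i).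
Proof.
split=> [/(_ 1)|]; last exact: kernel_padded_ill.
by rewrite mkseq_spike => /kernel_padded_singleton.
Qed.

Definition padded_name (p : baire) : baire := fun c =>
  if c == 0 then 1 else p (npair (chead c) (cstrip (ctail c))).

Lemma computable_padded_name : computable (fun p => Some (padded_name p)).
Proof.
apply: crec_computable; apply: crec_if (crec_eq0 crec_id) (crec_const 1) _.
apply: crec_oracle; apply: crec_pair.
  exact: crec_fst (crec_pred crec_id).
exact: crec_comp crec_cstrip (crec_snd (crec_pred crec_id)).
Qed.

Lemma tree_name_padded p Ts : @rname (seq_space tree_space) p Ts ->
  tree_name (padded_name p) (padded Ts).
Proof.
move=> pTs [|i s]; first by rewrite asboolT.
rewrite /padded_name [_ == 0]/= /chead /ctail /= npairK /= cstrip_code.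
exact: pTs.
Qed.

Lemma WF_le_PK : weihrauch_le (parallelization WF) PK.
Proof.
exists (fun p => Some (padded_name p)).
exists (fun s => Some (fun m => (odds s (npair (nfst m) 0).+1 == 0 : nat))).
split; first exact: computable_padded_name.
  apply: crec_computable; apply: crec_eq0; apply: crec_odds_at.
  exact: crec_succ (crec_pair (crec_fst crec_id) (crec_const 0)).
move=> p Ts pTs _; exists (padded_name p), (padded Ts); split=> //.
- exact: tree_name_padded.
- by exists (kernel (padded Ts)); exact: PK_kernel.
move=> q P qP PKP; eexists.
exists (fun i => `[< well_founded_tree (Ts i) >]); split; first by [].
  move=> i; rewrite /= /bool_name /proj_seq npairK oddsK.
  have -> := qP [:: i].
  have [Pi iP] := PK_unique PKP [:: i]; have [Ki iK] := kernel_paddedP Ts i.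
  case: asboolP => [/Pi/Ki|] nP; case: asboolP => // wf.
  by case: nP; exact/iP/iK.
by [].
Qed.

(** The inner factor for [lim_baire]: its outputs converge to the sequence of [WF] answers. *)
Definition WF_limits : problem (seq_space tree_space) (seq_space baire_space) :=
  fun Ts => [set u | (u : nat -> baire) n @[n --> \oo] -->
    ((fun i => `[< well_founded_tree (Ts i) >] : nat) : baire)].

(** Stage [n] asks whether the prefix of [spike i] of length [n.+1] is missing from the tree [Q].
    Trees are closed under prefixes, so the answer changes at most once and converges. *)
Lemma WF_limits_le_PK_baire : weihrauch_le WF_limits PK_baire.
Proof.
pose spike_code i n := (npair i (iter n (fun r => (npair 0 r).+1) 0)).+1.
have spike_codeE i n : spike_code i n = seq_code (i :: nseq n 0).
  rewrite /spike_code.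
  suff -> : iter n (fun r => (npair 0 r).+1) 0 = seq_code (nseq n 0) by [].
  by elim: n => //= n ->.
exists (fun p => Some (padded_name p)).
exists (fun s => Some (fun m =>
  (odds s (spike_code (nsnd m) (nfst m)) == 0 : nat))).
split; first exact: computable_padded_name.
  apply: crec_computable; apply: crec_eq0; apply: crec_odds_at.
  apply: crec_succ; apply: crec_pair (crec_snd crec_id) _.
  apply: crec_iter (crec_fst crec_id) (crec_const 0).
  exact: crec_succ (crec_pair (crec_const 0) (crec_snd crec_id)).
move=> p Ts pTs _.
pose A : closed_set := exist _ _ (@body_closed (padded Ts)).
exists (padded_name p), A; split=> //.
- by exists (padded Ts) => //; exact: tree_name_padded.
- by eexists; exact: PK_baire_kernel.
move=> q K [Q qQ QK] PKK; have KE := PK_baire_unique (erefl : _ = sval A) PKK.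
eexists; exists (fun n i => ~~ `[< sval Q (i :: nseq n 0) >] : nat).
split; first by [].
  move=> n; apply: funext => i.
  rewrite /proj_seq npairK oddsK spike_codeE qQ.
  by case: asboolP.
apply: baire_cvg => i; case: asboolP => wf; last first.
  exists 0 => // n _ /=; rewrite asboolT// -mkseq_spike.
  have := (body_kernel_paddedP Ts i).2 wf.
  by rewrite -KE -QK; exact.
have : ~ body Q (spike i).
  by rewrite QK KE => /body_kernel_paddedP.
move=> /existsNP[n nQ]; exists n => // m /= nm; case: asboolP => // Qm.
case: nQ; apply: (svalP Q) Qm; rewrite -mkseq_spike; apply: prefix_mkseq.
exact: leqW.
Qed.

Lemma WF_le_lim : weihrauch_le (parallelization WF) (pcomp lim_baire WF_limits).
Proof.
exists (fun p => Some p), (fun s => Some (fun m => odds s (nfst m))); split.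
- exact: crec_computable (crec_oracle crec_id).
- exact: crec_computable (crec_odds_at (crec_fst crec_id)).
move=> p Ts pTs _; exists p, Ts; split=> //.
  exists (fun i => `[< well_founded_tree (Ts i) >] : nat); split.
    by move=> u uP; eexists; exact: uP.
  by exists (fun _ i => `[< well_founded_tree (Ts i) >] : nat); exact: cvg_cst.
move=> q z qz [_ [u uwf uz]]; eexists.
exists (fun i => `[< well_founded_tree (Ts i) >]); split; [by []| |by []].
move=> i; rewrite /= /bool_name /proj_seq npairK oddsK (qz : q = z).
(* Both limits of [u] agree with a common late term at coordinate [i]. *)
have [N _ NP] := filterI (uz _ (nbhs_agree _ i.+1)) (uwf _ (nbhs_agree _ i.+1)).
by have [/(_ i (leqnn _)) /= -> /(_ i (leqnn _)) /= <-] := NP N (leqnn N).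
Qed.

(** * Non-reducibility *)

(** Nodes are pairs of compatible prefixes of [p] and of a witness. Membership of [s] depends on [p]
    below [size s], which is at most [seq_code s], so [p] is defined by course-of-values recursion;
    closedness of [R] turns paths into witnesses. *)
Lemma diagonal_tree (R : baire -> baire -> Prop) :
  (forall p x, (forall k, exists p' x',
    [/\ agree k p p', agree k x x' & R p' x']) -> R p x) ->
  exists p T, tree_name p T /\ (~ well_founded_tree T <-> exists x, R p x).
Proof.
move=> Rclosed.
pose F (l : seq nat) (n : nat) := `[< exists s p' x',
  [/\ seq_code s = n, forall i, i < size s -> p' i = nth 0 l i,
      s = mkseq x' (size s) & R p' x'] >] : nat.
(* [L n] lists the first [n] bits of [p], and [F] decides the next one from them. *)
pose L := nat_rect (fun=> seq nat) [::] (fun n l => rcons l (F l n)).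
pose p : baire := fun n => F (L n) n.
have L_size n : size (L n) = n by elim: n => //= n IH; rewrite size_rcons IH.
have L_nth n i : i < n -> nth 0 (L n) i = p i.
  elim: n => // n IH; rewrite ltnS leq_eqVlt /= nth_rcons L_size.
  by move=> /predU1P[->|lt]; [rewrite ltnn eqxx|rewrite lt IH].
pose E := [set s | exists p' x',
  [/\ agree (size s) p p', s = mkseq x' (size s) & R p' x']].
have Etree : is_tree E.
  move=> s t st [p' [x' [pp' tx' Rp'x']]]; exists p', x'; split=> //.
    by apply: agree_le pp'; exact: size_prefix.
  by rewrite tx' in st; exact: prefix_mkseqE st.
exists p, (exist _ _ Etree); split=> [s|].
  rewrite /p /F /=; congr (nat_of_bool _); apply: asbool_equiv_eq; split.
    move=> [t [p' [x' [/seq_code_inj -> pp' sx' Rp'x']]]]; exists p', x'.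
    split=> // i is_; rewrite pp'// L_nth//.
    exact: leq_trans is_ (size_code s).
  move=> [p' [x' [pp' sx' Rp'x']]]; exists s, p', x'; split=> // i is_.
  by rewrite -pp'// L_nth//; exact: leq_trans is_ (size_code s).
split=> [/eqP/set0P[x Tx]|[x Rpx] wf].
  exists x; apply: Rclosed => k; have [p' [x' [+ + Rp'x']]] := Tx k.
  by rewrite size_mkseq => pp' /eq_mkseq xx'; exists p', x'.
suff: set0 x by [].
by rewrite -wf => n /=; exists p, x; rewrite size_mkseq.
Qed.

(** A name of the constant sequence whose terms all have the name [p]. *)
Definition repeated (p : baire) : baire := fun n => p (nsnd n).

Lemma agree_repeated k p q : agree k p q -> agree k (repeated p) (repeated q).
Proof.
move=> pq i ik; apply: pq; apply: leq_ltn_trans ik.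
by rewrite -{2}(nunpairK i); exact: npair_ge2.
Qed.

Lemma agree_interleave k p q p' q' : agree k p p' -> agree k q q' ->
  agree k (interleave p q) (interleave p' q').
Proof.
move=> pp' qq' i ik; have i2 : i./2 < k.
  by apply: leq_ltn_trans ik; rewrite leq_half_double -addnn leqW ?leq_addr.
by rewrite /interleave; case: ifP => _; [exact: qq'|exact: pp'].
Qed.

(** Finite information about [p] and [Q] already commits [P] to the ill-founded answer; [npair 0 0]
    is the answer bit of component 0. *)
Definition forces0 (P : prog) (k : nat) (p : baire) (Q : tree) : Prop :=
  forall p' q : baire, agree k p p' ->
    (forall s, seq_code s < k -> q (seq_code s) = `[< sval Q s >] :> nat) ->
    eval (interleave (repeated p') q) P (npair 0 0) 0.

(* [x] codes a perfect subtree of the tree computed by [F], and [P] does not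
   answer "ill-founded" on any tree that contains the subtree. *)
Definition rejects (F P : prog) (p x : baire) : Prop :=
  (forall i, x i != 0 -> [/\ split_code i (x i), x (nfst (x i).-1) != 0,
    x (nsnd (x i).-1) != 0 & ~ eval (repeated p) F i 0]) /\
  ~ exists k Q, (forall s, seq_code s < k -> x (seq_code s) != 0 -> sval Q s) /\
      forces0 P k p Q.

(** Violations are finite events: a halting computation of [F] has a finite use, and a forced answer
    involves only the first [k] values of [p] and [x]. *)
Lemma rejects_closed F P p x :
  (forall k, exists p' x',
    [/\ agree k p p', agree k x x' & rejects F P p' x']) -> rejects F P p x.
Proof.
move=> cl; split=> [i xi|[k [Q [xQ Q0]]]].
  have [p' [x' [_ xx' [+ _]]]] := cl (i + nfst (x i).-1 + nsnd (x i).-1).+1.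
  move=> /(_ i); rewrite -xx'; last by rewrite ltnS -addnA leq_addr.
  move=> /(_ xi)[spl xa xb _]; rewrite -!xx' in xa xb; last 2 first.
  - by rewrite ltnS leq_addl.
  - by rewrite ltnS addnAC leq_addl.
  split=> // /eval_continuous[k kP].
  (* A second approximation is taken, close enough to share the use [k] of the halting
     computation. *)
  have [p'' [x'' [pp'' xx'' [x''P _]]]] := cl (maxn k i.+1).
  have [|_ _ _] := x''P i; first by rewrite -xx''// leq_maxr.
  apply; apply: kP; apply: agree_repeated; apply: agree_le pp''.
  exact: leq_maxl.
have [p' [x' [pp' xx' [_ []]]]] := cl k; exists k, Q; split=> [s sk|p'' q p'p''].
  by rewrite -xx'//; exact: xQ.
by apply: Q0; exact: agree_trans p'p''.
Qed.

(* A name of a closed set may contain any finite tree. *)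
Lemma extend_kernel (Y Q : tree) (k : nat) :
  (forall s, seq_code s < k -> sval (kernel Y) s -> sval Q s) ->
  exists2 Q' : tree, body Q' = body (kernel Y) &
    forall s, seq_code s < k -> (sval Q' s <-> sval Q s).
Proof.
move=> KQ.
have Etree : is_tree [set s | sval (kernel Y) s \/
    exists t, [/\ prefix s t, seq_code t < k & sval Q t]].
  move=> s t st [Kt|[u [tu uk Qu]]]; first by left; exact: (svalP (kernel Y)) Kt.
  by right; exists u; split=> //; exact: prefix_trans tu.
exists (exist _ _ Etree) => [|s sk]; last first.
  split=> [/= [|[t [st _]]]|Qs]; first exact: KQ.
    exact: (svalP Q).
  by right; exists s; rewrite prefix_refl.
apply/seteqP; split=> x xP n; last by left; exact: xP.
(* A prefix of length at least [k] cannot lie below a node with code less than [k], so the added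
   nodes create no path. *)
have [Kx|[t [/size_prefix + tk _]]] := xP (n + k).
  by apply: (svalP (kernel Y)) Kx; apply: prefix_mkseq; exact: leq_addr.
rewrite size_mkseq => nkt; have := leq_trans nkt (size_code t).
by rewrite leqNgt (leq_trans tk)// leq_addl.
Qed.

Lemma not_WF_le_PK_baire : ~ weihrauch_le (parallelization WF) PK_baire.
Proof.
move=> [Phi [Psi [[F FP] [P PP] red]]].
have [p [T [pT TR]]] := diagonal_tree (@rejects_closed F P).
have [||y [A [Phip [Y yY YA] _ ans]]] := red (repeated p) (fun=> T).
- move=> i s; rewrite /proj_seq /repeated npairK; exact: pT.
- exact: pdom_WF.
have Fy := FP _ _ Phip.
(* Every tree with the body of the kernel names the same closed set, so [P] must answer correctly on
   all of them. *)
have Pans Q q : tree_name q Q -> body Q = body (kernel Y) ->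
    eval (interleave (repeated p) q) P (npair 0 0) `[< well_founded_tree T >].
  move=> qQ QY; pose K : closed_set := exist _ _ (@body_closed (kernel Y)).
  have [|r [w [Psiq rw wP]]] := ans q K _ (PK_baire_kernel YA); first by exists Q.
  rewrite -(wP 0 : w 0 = _).
  have <- : r (npair 0 0) = w 0 by exact: rw.
  exact: PP Psiq _.
have [wf|ill] := pselect (well_founded_tree T).
  suff : exists x, rejects F P p x by move/TR; exact.
  (* The code of the whole kernel is a rejecting witness: a [Q] forcing 0 could be imitated below
     [k] by a name of the kernel, where [P] has to answer 1. *)
  have [x xP Kx] := perfect_code_kernel yY; exists x; split.
    move=> i /xP[/andP[/eqP yi spl] xa xb]; split=> // /(eval_functional (Fy i)).
    by rewrite yi.
  move=> [k [Q [xQ Q0]]].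
  have [|Q' Q'Y Q'Q] := @extend_kernel Y Q k.
    by move=> s sk /Kx; exact: xQ.
  have [q qQ'] := tree_name_surjective Q'.
  have := Pans Q' q qQ' Q'Y; rewrite asboolT// => Pq1.
  suff Pq0 : eval (interleave (repeated p) q) P (npair 0 0) 0.
    by have := eval_functional Pq0 Pq1.
  apply: Q0 => // s sk; rewrite qQ'; congr (nat_of_bool _).
  exact/asbool_equiv_eq/Q'Q.
(* The perfect subtree coded by [x] lies inside the kernel, on whose own name [P] answers 0; by
   continuity the kernel forces 0, which contradicts rejection. *)
have [x [xP []]] := TR.1 ill.
have [q qK] := tree_name_surjective (kernel Y).
have := Pans _ q qK erefl; rewrite asboolF// => /eval_continuous[k kP].
exists k, (kernel Y); split=> [s _|p' q' pp' q'K].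
  apply: (perfect_code_sub yY) => i xi; have [-> -> -> nF] := xP i xi.
  split=> //; rewrite andbT; have [s' s'E] := seq_code_surj i.
  have := Fy i; rewrite -s'E yY; case: asboolP => // _; rewrite s'E => Fi.
  by case: nF.
apply: kP; apply: agree_interleave; first exact: agree_repeated.
move=> i ik; have [s sE] := seq_code_surj i.
by rewrite -sE qK q'K// sE.
Qed.

Theorem theorem4p11 :
  weihrauch_lt PK_baire (parallelization WF) /\
  weihrauch_equiv (parallelization WF) PK /\
  (forall (U V : repSpace) (h : problem U V),
     is_comp_product lim_baire PK_baire h -> weihrauch_le PK h).
Proof.
split; first by split; [exact: PK_baire_le_WF|exact: not_WF_le_PK_baire].
split; first by split; [exact: WF_le_PK|exact: PK_le_WF].
move=> U V h [_ hmax].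
apply: weihrauch_le_trans PK_le_WF _; apply: weihrauch_le_trans WF_le_lim _.
by apply: hmax; [exact: weihrauch_le_refl|exact: WF_limits_le_PK_baire].
Qed.
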